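(* Let $(S,\cdot)$ be an adequate partial semigroup and let $B\subseteq S$. Then $B$ is central if and only if $B$ is dynamically central.
   Context: Notation: for a set $Y$, $\mathcal{P}_f(Y)$ denotes the set of nonempty finite subsets of $Y$. Partial semigroup: a pair $(S,\cdot)$ with $S$ a nonempty set and $\cdot$ a map from a subset of $S\times S$ to $S$ such that for all $a,b,c\in S$, $(a\cdot b)\cdot c=a\cdot(b\cdot c)$ in the sense that if either side is defined then so is the other and they are equal. For $s\in S$, $\phi(s)=\{t\in S: s\cdot t\text{ is defined}\}$; for $H\in\mathcal{P}_f(S)$, $\sigma(H)=\bigcap_{s\in H}\phi(s)$. $S$ is adequate if $\sigma(H)\neq\emptyset$ for all $H\in\mathcal{P}_f(S)$. For $x\in S$ and $A\subseteq S$, $x^{-1}A=\{y\in\phi(x): x\cdot y\in A\}$. $\beta S$ is the Stone-Čech compactification of the discrete space $S$ (the set of ultrafilters on $S$, with basis the sets $\overline{A}=\{p\in\beta S: A\in p\}$, $A\subseteq S$). $\delta S=\bigcap_{x\in S}\overline{\phi(x)}=\bigcap_{H\in\mathcal{P}_f(S)}\overline{\sigma(H)}$. For $p\in\beta S$ and $q\in\delta S$, the product $pq=p\cdot q\in\beta S$ is given by: $A\in p\cdot q\iff\{x\in S: x^{-1}A\in q\}\in p$. With this operation $\delta S$ is a compact Hausdorff right topological semigroup. A left ideal of $\delta S$ is a nonempty $L\subseteq\delta S$ with $\delta S\cdot L\subseteq L$. Idempotents of $\delta S$ are ordered by $p\le q\iff pq=qp=p$; an idempotent is minimal if it is minimal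 for this order (equivalently, it belongs to a minimal left ideal of $\delta S$, i.e. to the smallest two-sided ideal of $\delta S$). Central: $A\subseteq S$ is central if there is a minimal idempotent $p\in\delta S$ with $A\in p$. Dynamical system (for an adequate partial semigroup $S$): a pair $(X,\langle T_s\rangle_{s\in S})$ such that $X$ is a compact Hausdorff space, each $T_s:X\to X$ is continuous, and for all $s,t\in S$, $T_sT_t=T_{st}$ whenever $t\in\phi(s)$. Syndetic: $A\subseteq S$ is syndetic if $\overline{A}\cap L\neq\emptyset$ for every left ideal $L$ of $\delta S$. Uniformly recurrent: a point $y\in X$ is uniformly recurrent if for every neighborhood $U$ of $y$, $\{s\in S: T_s(y)\in U\}$ is syndetic. Proximal: points $x,y\in X$ are proximal if for every neighborhood $U$ of the diagonal in $X\times X$ and every $H\in\mathcal{P}_f(S)$ there is some $s\in\sigma(H)$ with $(T_s(x),T_s(y))\in U$. Dynamically central: $C\subseteq S$ is dynamically central if there exist a dynamical system $(X,\langle T_s\rangle_{s\in S})$, points $x,y\in X$, and a neighborhood $U$ of $y$ such that (1) $y$ is a uniformly recurrent point of $X$, (2) $x$ and $y$ are proximal, and (3) $C=\{s\in S: T_s(x)\in U\}$. *)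

(* Defs.v *)
From mathcomp Require Import all_boot.
From mathcomp Require Import boolp classical_sets functions cardinality filter.
From mathcomp Require Import topology.

Set Implicit Arguments.
Unset Strict Implicit.
Unset Printing Implicit Defensive.

Local Open Scope classical_set_scope.

(* [pmul a b = None] means that the product of a and b is undefined, so an
   equality between two option-valued expressions says that one side is defined
   iff the other is, and that the values then agree. *)
Record partialSemigroup := PartialSemigroup {
  psort :> Type;
  psort_nonempty : inhabited psort;
  pmul : psort -> psort -> option psort;
  pmulA : forall a b c : psort,
    obind (fun ab => pmul ab c) (pmul a b) =
    obind (fun bc => pmul a bc) (pmul b c)
}.

Definition nonempty_finite {T : Type} (H : set T) : Prop :=
  finite_set H /\ H !=set0.

Section PartialSemigroupTheory.
Variable S : partialSemigroup.
Implicit Types (s t x y : S) (A B H : set S) (p q : set_system S).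

Definition phi s : set S := [set t | isSome (pmul s t)].

Definition sigma H : set S := \bigcap_(s in H) phi s.

Definition adequate : Prop :=
  forall H, nonempty_finite H -> sigma H !=set0.

(* x^{-1} A *)
Definition lquot x A : set S := [set y | exists2 z, pmul x y = Some z & A z].

(* Points of the Stone-Cech compactification of the discrete space S are
   represented by the ultrafilters on S, seen as sets of subsets of S. *)
Definition betaS : set (set_system S) := [set p | UltraFilter p].

(* The basic clopen subset of betaS determined by A. *)
Definition bcl A : set (set_system S) := [set p | betaS p /\ p A].

Definition deltaS : set (set_system S) := \bigcap_(x in [set: S]) bcl (phi x).

(* Written for arbitrary p and q; by [bmul_betaS] and [bmul_deltaS] below it
   maps betaS x deltaS to betaS and deltaS x deltaS to deltaS. *)
Definition bmul p q : set_system S := [set A | p [set x | q (lquot x A)]].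

Definition left_ideal (L : set (set_system S)) : Prop :=
  [/\ L !=set0, L `<=` deltaS &
      forall p q, deltaS p -> L q -> L (bmul p q)].

Definition idempotent p : Prop := deltaS p /\ bmul p p = p.

Definition idem_le p q : Prop := bmul p q = p /\ bmul q p = p.

Definition minimal_idempotent p : Prop :=
  idempotent p /\ forall q, idempotent q -> idem_le q p -> q = p.

Definition central A : Prop := exists2 p, minimal_idempotent p & p A.

Definition syndetic A : Prop :=
  forall L, left_ideal L -> bcl A `&` L !=set0.

Record dynamicalSystem := DynamicalSystem {
  dspace :> topologicalType;
  dspace_compact : compact [set: dspace];
  dspace_hausdorff : hausdorff_space dspace;
  dact : S -> dspace -> dspace;
  dact_continuous : forall s, continuous (dact s);
  dactM : forall s t st, pmul s t = Some st -> dact s \o dact t = dact st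
}.

Definition uniformly_recurrent (X : dynamicalSystem) (y : X) : Prop :=
  forall U : set X, nbhs y U -> syndetic [set s | U (dact s y)].

Definition nbhs_diagonal (X : topologicalType) (U : set (X * X)) : Prop :=
  forall z : X, nbhs (z, z) U.

Definition proximal (X : dynamicalSystem) (x y : X) : Prop :=
  forall (U : set (X * X)) H, nbhs_diagonal U -> nonempty_finite H ->
    exists2 s, sigma H s & U (dact s x, dact s y).

Definition dynamically_central (C : set S) : Prop :=
  exists (X : dynamicalSystem) (x y : X) (U : set X),
    [/\ nbhs y U, uniformly_recurrent y, proximal x y &
        C = [set s | U (dact s x)]].

Lemma bmul_betaS p q : betaS p -> deltaS q -> betaS (bmul p q).
Proof.
rewrite /betaS /= => pU dq; have [s0] := psort_nonempty S.
have qU : UltraFilter q by have [] := dq s0 I.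
have qphi x : q (phi x) by have [] := dq x I.
have PF : ProperFilter (bmul p q).
  split.
    rewrite /bmul /= => p0.
    have [x qx] := filter_ex p0.
    by have [y []] := filter_ex qx.
  split.
  - apply: (@filterS _ p _ setT) => [x _ /=|]; last exact: filterT.
    apply: filterS (qphi x) => y; rewrite /phi /lquot /=.
    by case: pmul => // z _; exists z.
  - move=> A B; apply: (filterS2 (F := p)) => x /= qA qB.
    apply: filterS2 qA qB => y [z e Az] [w e' Bw].
    by exists z => //; split=> //; move: e'; rewrite e => -[->].
  - move=> A B AB; apply: (filterS (F := p)) => x; apply: (filterS (F := q)) => y [z e Az].
    by exists z => //; exact: AB.
split=> // G PG sG; rewrite eqEsubset; split=> // A GA.
have [//|pC] := @in_ultra_setVsetC _ p [set x | q (lquot x A)] pU.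
suff GC : G (~` A) by have [z []] := filter_ex (filterI GA GC).
apply: sG; apply: (filterS (F := p)) pC => x /= nq.
have [//|qC] := @in_ultra_setVsetC _ q (lquot x A) qU.
apply: filterS2 (qphi x) qC => y; rewrite /phi /lquot /=.
case e : (pmul x y) => [z|] // _ nz; exists z => // Az.
by apply: nz; exists z.
Qed.

Lemma bmul_deltaS p q : deltaS p -> deltaS q -> deltaS (bmul p q).
Proof.
move=> dp dq x _; have [pU px] := dp x I; rewrite /betaS /= in pU.
split; first exact: bmul_betaS.
apply: (filterS (F := p)) px => a; rewrite /phi /=.
case e : (pmul x a) => [xa|] // _.
have [qU qxa] := dq xa I; rewrite /betaS /= in qU; have [_ qa] := dq a I.
apply: filterS2 qa qxa => y; rewrite /phi /lquot /=.
have := pmulA x a y; rewrite e /=.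
by case: (pmul a y) => [z|] //= -> _ ?; exists z.
Qed.

End PartialSemigroupTheory.

(* Main.v *)
From mathcomp Require Import all_boot.
From mathcomp Require Import boolp classical_sets cardinality filter.
From mathcomp Require Import topology.
Require Import Defs.

Set Implicit Arguments.
Unset Strict Implicit.
Unset Printing Implicit Defensive.

Local Open Scope classical_set_scope.

(** The closed subsets of the space of ultrafilters on a set are exactly the
sets [hull E] of all ultrafilters that refine a family [E]. Describing a closed
set by the family of all sets common to its members turns compactness into the
ultrafilter lemma and the search for minimal closed sets into Zorn's lemma for
inclusion of families, so that the Ellis theory of the compact right
topological semigroup deltaS can be developed directly on families of sets.
Two facts of this theory carry the proof.

- Every closed left ideal of deltaS contains a minimal left ideal, and a
  nonempty closed subsemigroup of a minimal left ideal contains an idempotent,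
  which is then minimal ([minimal_left_ideal_exists], [ellis],
  [idempotent_minimal]).
- If [p] is a minimal idempotent, then every left ideal contains some [q] with
  [q p = p] ([minimal_idempotent_absorb]).

In a dynamical system let [T_p x] denote the limit of [T_s x] along the
ultrafilter [p]. Then [T_q (T_p x) = T_(q p) x] ([limit_along_bmul]).

If [B = {s | T_s x \in U}] is dynamically central through [x], [y] and [U],
then proximality provides [r] in deltaS with [T_r x = T_r y], and this equality
persists on the whole left ideal [deltaS r]. Let [M] be a minimal left ideal
inside it. Uniform recurrence of [y] makes [{q \in M | T_q y = y}] nonempty;
this is a closed subsemigroup of [M], so it contains a minimal idempotent [p].
Then [T_p x = T_p y = y], whence [B] belongs to [p].

Conversely let [B] belong to a minimal idempotent [p]. In the shift system on
functions from [S] with an adjoined identity [e] to [bool], with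
[(T_s f) t = f (t s)], let [x] be the indicator function of [B], [y = T_p x] and
[U = {f | f e}]. Since [(T_s x) e = x s], the set of return times of [x] to [U]
is exactly [B], and [y] belongs to [U] because [B] belongs to [p]. The points
[x] and [y] are proximal because [T_p y = T_(p p) x = T_p x]. Finally [y] is
uniformly recurrent because every left ideal contains some [q] with [q p = p],
and for this [q] we have [T_q y = T_(q p) x = y]. *)

(** * Closed sets of ultrafilters *)

Section UltraSets.
Variable T : Type.
Implicit Types (E : set_system T) (K : set (set_system T)).

Definition hull E : set (set_system T) := [set p | UltraFilter p /\ E `<=` p].

Definition common K : set_system T := [set A | forall p, K p -> p A].

(** An ultrafilter [p] lies in the closure of [K] iff every set in [common K]
belongs to [p], so the equation says that [K] is closed. *)
Definition uclosed K : Prop := K = hull (common K).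

Lemma hull_uclosed E : uclosed (hull E).
Proof.
rewrite /uclosed eqEsubset; split=> p [pU Ep]; split=> //.
- by move=> A; apply; split.
- by apply: subset_trans Ep => A EA q [_]; apply.
Qed.

Lemma uclosedI K K' : uclosed K -> uclosed K' -> uclosed (K `&` K').
Proof.
move=> -> ->; rewrite (_ : _ `&` _ = hull (common K `|` common K')).
  exact: hull_uclosed.
rewrite eqEsubset; split=> [p [[pU pK] [_ pK']]|p [pU pKK]].
  by split=> // A [/pK|/pK'].
by split; split=> // A KA; apply: pKK; [left|right].
Qed.

Lemma common_proper K : uclosed K -> K !=set0 -> ProperFilter (common K).
Proof.
move=> cK [p0 Kp0]; have KU p : K p -> UltraFilter p by rewrite cK => -[].
split; first by move=> /(_ p0 Kp0); have := KU _ Kp0 => ? /filter_ex [].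
split=> [p /KU pU|A B KA KB p Kp|A B AB KA p Kp].
- exact: filterT.
- by have := KU _ Kp => ?; apply: filterI; [exact: KA|exact: KB].
- by have := KU _ Kp => ?; apply: filterS AB _; exact: KA.
Qed.

(** Zorn's lemma applies because an intersection of a chain of nonempty closed
sets is nonempty: the union of a chain of proper filters is a proper filter. *)
Lemma minimal_uclosed (Q : set (set_system T) -> Prop) K0 :
  uclosed K0 -> K0 !=set0 -> Q K0 ->
  (forall D : set (set (set_system T)),
     D !=set0 -> D `<=` Q -> Q (\bigcap_(K in D) K)) ->
  exists K, [/\ uclosed K, K !=set0, K `<=` K0, Q K &
    forall K', uclosed K' -> K' !=set0 -> K' `<=` K -> Q K' -> K' = K].
Proof.
move=> cK0 K00 QK0 Qcap.
pose good E := [/\ ProperFilter E, hull E `<=` K0 & Q (hull E)].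
(* The empty family has to be allowed as the union of the empty chain. *)
pose P E := E = set0 \/ good E.
have Pcommon K : uclosed K -> K !=set0 -> K `<=` K0 -> Q K -> P (common K).
  move=> cK K_0 KK0 QK; right; rewrite /good -cK.
  by split=> //; exact: common_proper.
have [F FP Ftot|E [PE Emax]] := @Zorn_bigcup _ P.
  have [->|/set0P[A0 [E0 FE0 EA0]]] := eqVneq (\bigcup_(X in F) X) set0.
    by left.
  have goodF E A : F E -> E A -> good E by move=> /FP[->//|].
  have [E0F E0K QE0] := goodF _ _ FE0 EA0.
  right; split.
  - split.
      by move=> [E FE E_0]; have [? _ _] := goodF _ _ FE E_0;
        apply: filter_not_empty E_0.
    split.
    + by exists E0 => //; exact: filterT.
    + move=> A B [E FE EA] [E' FE' EB].
      have [? _ _] := goodF _ _ FE EA; have [? _ _] := goodF _ _ FE' EB.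
      have [EE'|EE'] := Ftot _ _ FE FE'.
        by exists E' => //; apply: filterI => //; exact: EE'.
      by exists E => //; apply: filterI => //; exact: EE'.
    + move=> A B AB [E FE EA]; exists E => //.
      by have [? _ _] := goodF _ _ FE EA; apply: filterS EA.
  - by move=> p [pU Fp]; apply: E0K; split=> // A EA; apply: Fp; exists E0.
  - pose D := [set hull E | E in F `&` [set E | E !=set0]].
    rewrite (_ : hull _ = \bigcap_(K in D) K).
      apply: Qcap; first by exists (hull E0), E0 => //; split=> //; exists A0.
      by move=> _ [E [FE [A EA]] <-]; have [] := goodF _ _ FE EA.
    rewrite eqEsubset; split=> p.
      move=> [pU Fp] _ [E [FE _] <-]; split=> // A EA.
      by apply: Fp; exists E.
    move=> hp; have [pU _] : hull E0 p.
      by apply: hp; exists E0 => //; split=> //; exists A0.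
    split=> // A [E FE EA].
    by have [|_] := hp (hull E); [exists E => //; split=> //; exists A|apply].
have [E0|[EP EK0 QE]] := PE.
  exfalso; apply: (Emax (common K0)); last exact: Pcommon.
  rewrite E0; split=> [A //|/(_ setT)]; apply.
  by move=> p; rewrite cK0 => -[pU _]; exact: filterT.
exists (hull E); split=> //; first exact: hull_uclosed.
  by have [p [pU Ep]] := ultraFilterLemma EP; exists p.
move=> K cK K_0 KE QK; rewrite eqEsubset; split=> // p [pU Ep].
rewrite cK; split=> //; apply: subset_trans Ep; apply: contrapT => nKE.
apply: (Emax (common K)).
  by split=> // A EA q /KE[_]; apply.
by apply: Pcommon => //; exact: subset_trans EK0.
Qed.

(** Compactness in the form used below: the closed set described by a filter [E]
meets the closed set described by a filter base [g] as soon as the members of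
[E] meet those of [g]. *)
Lemma ultra_refines (I : Type) (D : set I) (g : I -> set T) E :
  Filter E -> D !=set0 ->
  (forall i j, D i -> D j -> exists2 k, D k & g k `<=` g i `&` g j) ->
  (forall A i, E A -> D i -> A `&` g i !=set0) ->
  exists2 p, hull E p & forall i, D i -> p (g i).
Proof.
move=> EF [i0 Di0] gI Eg.
pose G := filter_from [set Ai : set T * I | E Ai.1 /\ D Ai.2]
  (fun Ai => Ai.1 `&` g Ai.2).
have GF : ProperFilter G.
  apply: filter_from_proper => [|[A i] [EA Di]]; last exact: Eg.
  apply: filter_from_filter.
    by exists (setT, i0); split=> //; exact: filterT.
  move=> [A i] [B j] [/= EA Di] [EB Dj]; have [k Dk gk] := gI _ _ Di Dj.
  exists (A `&` B, k); first by split=> //; exact: filterI.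
  by move=> x [[Ax Bx] /gk[gi gj]]; split; split.
have [p [pU Gp]] := ultraFilterLemma GF.
exists p; first split=> // A EA; first by apply: Gp; exists (A, i0) => // x [].
move=> i Di; apply: Gp; exists (setT, i) => [|x []//].
by split=> //; exact: filterT.
Qed.

End UltraSets.

(** * The semigroup deltaS and its minimal left ideals *)

Section DeltaS.
Variable S : partialSemigroup.
Implicit Types (A B : set S) (p q r : set_system S) (K L : set (set_system S)).

Lemma deltaS_ultra p : deltaS p -> UltraFilter p.
Proof. by have [s] := psort_nonempty S; move=> /(_ s I)[]. Qed.

Lemma deltaS_proper p : deltaS p -> ProperFilter p.
Proof. by move=> /deltaS_ultra pU; exact: ultra_proper. Qed.

Lemma deltaS_phi p s : deltaS p -> p (phi s).
Proof. by move=> /(_ s I)[]. Qed.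

Lemma uclosed_deltaS : uclosed (@deltaS S).
Proof.
rewrite (_ : @deltaS S = hull (range (@phi S))); first exact: hull_uclosed.
rewrite eqEsubset; split=> p.
  by move=> dp; split=> [|_ [s _ <-]]; [exact: deltaS_ultra|exact: deltaS_phi].
by move=> [pU hp] s _; split=> //; apply: hp; exists s.
Qed.

Lemma deltaS_sigma p H : deltaS p -> finite_set H -> p (sigma H).
Proof.
move=> dp /(@finite_fsetP {classic S})[X ->]; have pU := deltaS_ultra dp.
by apply: (@filter_bigI _ {classic S}) => s _; exact: deltaS_phi.
Qed.

Lemma lquot_lquot x y w A : pmul y x = Some w ->
  lquot x (lquot y A) = lquot w A.
Proof.
move=> yx; rewrite eqEsubset; split=> z.
  move=> [v xz [u yv Au]]; exists u => //.
  by have := pmulA y x z; rewrite yx xz /= => ->.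
move=> [u wz Au]; have := pmulA y x z; rewrite yx /= wz.
by case e : (pmul x z) => [v|] //= yv; exists v => //; exists u.
Qed.

Lemma bmulA p q r : ProperFilter r -> bmul (bmul p q) r = bmul p (bmul q r).
Proof.
move=> rF; apply/funext => A; congr (p _); apply/funext => y; congr (q _).
rewrite eqEsubset; split=> x /=.
  by move=> [w yx rw]; rewrite (lquot_lquot _ yx).
move=> rxy; have [z [v xz [u yv Au]]] := filter_ex rxy.
have := pmulA y x z; rewrite xz /= yv; case yx : (pmul y x) => [w|] //= wz.
by exists w => //=; rewrite -(lquot_lquot _ yx).
Qed.

(** Right translation by [q] is continuous, so it maps compact sets to closed
sets. Explicitly, if [r] is in the closure of [K q], then no set of [common K]
can miss a set [{x | x^-1 A \in q}] with [A] in [r], and an ultrafilter [p] of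
[K] that contains all of the latter satisfies [p q = r]. *)
Lemma bmul_uclosed K q : uclosed K -> deltaS q ->
  uclosed [set bmul p q | p in K].
Proof.
move=> cK dq; have qU := deltaS_ultra dq.
have KU p : K p -> UltraFilter p by rewrite cK => -[].
rewrite /uclosed eqEsubset; split=> [_ [p Kp <-]|r [rU Kr]].
  split; first by apply: bmul_betaS => //; exact: KU.
  by move=> A; apply; exists p.
have [K0|/set0P K_0] := eqVneq K set0.
  by have := filter_not_empty r; case; apply: Kr => p [p0]; rewrite K0.
have cKF := common_proper cK K_0.
have [|||p] := @ultra_refines _ _ r (fun A => [set x | q (lquot x A)])
    (common K) cKF.
- by exists setT; exact: filterT.
- move=> A B rA rB; exists (A `&` B); first exact: filterI.
  by move=> x /= qAB; split; apply: filterS qAB => y [z e []]; exists z.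
- move=> B A KB rA; apply: contrapT => BA0.
  (* otherwise x^-1 (~ A) would be in q for all x in B *)
  suff rC : r (~` A) by have [z []] := filter_ex (filterI rA rC).
  apply: Kr => _ [p Kp <-]; have pU := KU _ Kp.
  apply: (filterS (F := p)) (KB _ Kp) => x Bx /=.
  have [qA|qC] := @in_ultra_setVsetC _ q (lquot x A) qU.
    by exfalso; apply: BA0; exists x.
  apply: filterS2 (deltaS_phi x dq) qC => y; rewrite /phi /lquot /=.
  case e : (pmul x y) => [z|] // _ nz; exists z => // Az.
  by apply: nz; exists z.
- rewrite -cK => Kp rp; exists p => //; apply: max_filter => //.
  by have [] := bmul_betaS (KU _ Kp : betaS p) dq.
Qed.

Lemma fixer_uclosed K q : uclosed K -> deltaS q ->
  uclosed [set p | K p /\ bmul p q = q].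
Proof.
move=> cK dq; have qU := deltaS_ultra dq.
pose E := [set [set x | q (lquot x A)] | A in q].
rewrite (_ : [set p | _] = K `&` hull E).
  by apply: uclosedI => //; exact: hull_uclosed.
have KU p : K p -> UltraFilter p by rewrite cK => -[].
rewrite eqEsubset; split=> p [Kp].
  move=> pq; split=> //; split; first exact: KU.
  by move=> _ [A qA <-]; rewrite -pq in qA.
move=> [pU Ep]; split=> //; apply: max_filter => // [|A qA].
  by have [] := bmul_betaS (pU : betaS p) dq.
by apply: Ep; exists A.
Qed.

Definition subsemigroup K : Prop := forall p q, K p -> K q -> K (bmul p q).

(** In a minimal closed subsemigroup [M], for [q] in [M], both [M q] and
[{p \in M | p q = q}] are closed subsemigroups, hence equal to [M]. *)
Lemma ellis K : uclosed K -> K !=set0 -> K `<=` @deltaS S -> subsemigroup K ->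
  exists2 p, K p & idempotent p.
Proof.
move=> cK K0 KdS Ksg.
have [D _ Dsg p q Dp Dq M MD|M [cM [q Mq] MK Msg Mmin]] :=
    minimal_uclosed cK K0 Ksg.
  by apply: (Dsg M MD); [exact: Dp|exact: Dq].
have MdS := subset_trans MK KdS.
exists q; [exact: MK|split; first exact: MdS].
have qP := deltaS_proper (MdS _ Mq).
have Mq_M : [set bmul p q | p in M] = M.
  apply: Mmin.
  - by apply: bmul_uclosed => //; exact: MdS.
  - by exists (bmul q q), q.
  - by move=> _ [p Mp <-]; exact: Msg.
  - move=> _ _ [a Ma <-] [b Mb <-]; exists (bmul (bmul a q) b).
      by apply: (Msg) => //; exact: Msg.
    by rewrite bmulA.
have : M q by []; rewrite -{1}Mq_M => -[e Me eq_q].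
suff E : [set p | M p /\ bmul p q = q] = M.
  by move: Mq; rewrite -{1}E => -[].
apply: Mmin.
- by apply: fixer_uclosed => //; exact: MdS.
- by exists e.
- by move=> p [].
- move=> a b [Ma aq] [Mb bq]; split; first exact: Msg.
  by rewrite bmulA // bq.
Qed.

Lemma left_ideal_subsemigroup L : left_ideal L -> subsemigroup L.
Proof. by move=> [_ LdS LM] p q /LdS; exact: LM. Qed.

Lemma principal_left_ideal q : deltaS q ->
  left_ideal [set bmul p q | p in @deltaS S].
Proof.
move=> dq; have qP := deltaS_proper dq.
split=> [|_ [p dp <-]|p _ dp [r dr <-]].
- by exists (bmul q q), q.
- exact: bmul_deltaS.
- by exists (bmul p r); [exact: bmul_deltaS|rewrite bmulA].
Qed.

Definition minimal_left_ideal L : Prop := left_ideal L /\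
  forall L', left_ideal L' -> L' `<=` L -> L' = L.

(** A left ideal that is minimal among the closed ones is minimal: any left
ideal contains the closed left ideals generated by its elements. *)
Lemma minimal_left_ideal_exists L : left_ideal L -> uclosed L ->
  exists M, [/\ M `<=` L, uclosed M & minimal_left_ideal M].
Proof.
move=> [L0 LdS LM] cL.
pose Q K := K `<=` @deltaS S /\ forall p q, deltaS p -> K q -> K (bmul p q).
have [//|D [K DK] DQ|M [cM M0 ML [MdS MM] Mmin]] :=
    @minimal_uclosed _ Q _ cL L0.
  split=> [p /(_ _ DK)|p q dp Dq K' DK']; first exact: (DQ _ DK).1.
  exact: (DQ _ DK').2 (Dq _ DK').
exists M; split=> //; split=> // L' [[q L'q] L'dS L'M] L'sub.
have dq := L'dS _ L'q; have [Mq0 MqdS MqM] := principal_left_ideal dq.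
have MqL' : [set bmul p q | p in @deltaS S] `<=` L'.
  by move=> _ [p dp <-]; exact: L'M.
rewrite eqEsubset; split=> //; rewrite -[X in X `<=` _](Mmin _ _ Mq0) //.
- by apply: bmul_uclosed => //; exact: uclosed_deltaS.
- exact: subset_trans L'sub.
Qed.

(** If [e] is an idempotent below [p], then [e = e p] generates the left ideal
[L], so that [p = r e] for some [r], and thus [p = p e = e]. *)
Lemma idempotent_minimal L p : minimal_left_ideal L -> L p -> idempotent p ->
  minimal_idempotent p.
Proof.
move=> [[L0 LdS LM] Lmin] Lp [dp pp]; split=> // e [de ee] [ep pe].
have Le : L e by rewrite -ep; exact: LM.
have eP := deltaS_proper de.
have : [set bmul r e | r in @deltaS S] p.
  rewrite (Lmin _ (principal_left_ideal de)) //.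
  by move=> _ [r dr <-]; exact: LM.
by move=> [r dr re]; rewrite -pe -{1}re bmulA // ee re.
Qed.

(** For [l] in [L], the closed left ideal [deltaS l p] contains an idempotent
[e = r l p]. Then [p e] is an idempotent below [p], so [p = p e = (p r l) p],
and [p r l] belongs to [L]. *)
Lemma minimal_idempotent_absorb L p : minimal_idempotent p -> left_ideal L ->
  exists2 q, L q & bmul q p = p.
Proof.
move=> [[dp pp] pmin] [[l Ll] LdS LM]; have dl := LdS _ Ll.
have pP := deltaS_proper dp.
have lpd : deltaS (bmul l p) by exact: bmul_deltaS.
have lpI := principal_left_ideal lpd.
have [||||_ [r dr <-] [ed ee]] :=
    @ellis [set bmul r (bmul l p) | r in @deltaS S].
- by apply: bmul_uclosed => //; exact: uclosed_deltaS.
- by case: lpI.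
- by case: lpI.
- exact: left_ideal_subsemigroup.
set e := bmul r _ in ed ee.
have eP := deltaS_proper ed.
have ep : bmul e p = e by rewrite /e !bmulA // pp.
have pe : bmul p e = p.
  have peP := deltaS_proper (bmul_deltaS dp ed).
  apply: pmin; split.
  - exact: bmul_deltaS.
  - by rewrite bmulA // -(bmulA e) // ep ee.
  - by rewrite bmulA // ep.
  - by rewrite -bmulA // pp.
exists (bmul p (bmul r l)); last by rewrite !bmulA.
by apply: (LM) => //; exact: LM.
Qed.

End DeltaS.

(** * Limits along ultrafilters in a dynamical system *)

Section Dynamics.
Variables (S : partialSemigroup) (X : dynamicalSystem S).
Implicit Types (p q : set_system S) (x y z : X) (U V : set X).

Definition limit_along p x z : Prop :=
  forall V, nbhs z V -> p [set s | V (dact s x)].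

Lemma limit_along_exists p x : UltraFilter p -> exists z, limit_along p x z.
Proof.
move=> pU; have [|z [_ zcl]] := @dspace_compact S X ((@dact S X)^~ x @ p) _.
  exact: filterT.
exists z => V zV.
have [//|pC] := @in_ultra_setVsetC _ p [set s | V (dact s x)] pU.
by have [w []] := zcl (~` V) V pC zV.
Qed.

Lemma limit_along_unique p x z w : UltraFilter p ->
  limit_along p x z -> limit_along p x w -> z = w.
Proof.
move=> pU; apply: (cvg_unique (@dspace_hausdorff S X)
  (F := (@dact S X)^~ x @ p)).
Qed.

(** Only sets of the form [{s | V (T_s y)}] with [V] open are tested against
[q], so that continuity of each single [T_s] is enough; [p] has to be in deltaS
for [T_s T_t = T_(s t)] to be available for [p]-many [t]. *)
Lemma limit_along_bmul q p x y z : deltaS q -> deltaS p ->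
  limit_along p x y -> limit_along q y z -> limit_along (bmul q p) x z.
Proof.
move=> dq dp px qy V /nbhs_interior zV.
have qU := deltaS_ultra dq; have pU := deltaS_ultra dp.
apply: (filterS (F := q)) (qy _ zV) => s /= sV.
have {}sV := px _ (@dact_continuous S X s _ _ sV).
apply: (filterS2 (F := p)) (deltaS_phi s dp) sV => t; rewrite /phi /lquot /=.
case e : (pmul s t) => [st|] // _ stV; exists st => //.
by rewrite -(dactM X e).
Qed.

(** Regularity gives a closed neighbourhood [closure C] of [x] inside a
neighbourhood [A] of [x] that is disjoint from a neighbourhood of [y]; the pairs
[(u, v)] with [u] outside [closure C] or [v] in [A] then surround the
diagonal. *)
Lemma off_diagonal x y : x <> y ->
  exists W, nbhs_diagonal W /\ nbhs (x, y) (~` W).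
Proof.
move=> xy; have := @dspace_hausdorff S X; rewrite open_hausdorff => hX.
have /hX[[A A'] /= [xA yA'] [oA oA' AA']] : x != y by apply/eqP.
have regX : {for x, @regular_space X}.
  apply: compact_regular (@dspace_compact S X) filterT.
  exact: dspace_hausdorff.
have [|C xC CA] := regX A.
  by apply: open_nbhs_nbhs; split => //; rewrite inE in xA.
exists [set uv | ~ closure C uv.1 \/ A uv.2]; split=> [z|].
  have [Az|nAz] := pselect (A z).
    exists (setT, A); first split; [exact: filterT|exact: open_nbhs_nbhs|].
    by move=> [u v] [_ Av]; right.
  exists (~` closure C, setT); first split.
  - apply: open_nbhs_nbhs; split; last by move=> /CA.
    exact/closed_openC/closed_closure.
  - exact: filterT.
  - by move=> [u v] [Cu _]; left.
exists (C, A'); first split => //=.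
  by apply: open_nbhs_nbhs; split=> //; rewrite inE in yA'.
move=> [u v] [/= Cu A'v] [|Av]; first by apply; exact: subset_closure.
by have : (A `&` A') v by []; rewrite (eqP AA').
Qed.

(** Take an ultrafilter that contains the sets [sigma H], which puts it in
deltaS, and the sets [{s | W (T_s x, T_s y)}] for neighbourhoods [W] of the
diagonal, which leaves no room for two different limits. *)
Lemma proximal_common_limit x y : proximal x y ->
  exists2 q, deltaS q & exists z, limit_along q x z /\ limit_along q y z.
Proof.
move=> pxy; have [s0] := psort_nonempty S.
pose E := filter_from (@nonempty_finite S) (@sigma S).
have EF : Filter E.
  apply: filter_from_filter.
    by exists [set s0]; split; [exact: finite_set1|exists s0].
  move=> H H' [fH [h Hh]] [fH' _]; exists (H `|` H').
    by split; [rewrite finite_setU|exists h; left].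
  by move=> s Hs; split=> t Ht; apply: Hs; [left|right].
have [|||q [qU Eq] qW] := @ultra_refines S _ (@nbhs_diagonal X)
  (fun W => [set s | W (dact s x, dact s y)]) E EF.
- by exists setT => z; exact: filterT.
- by move=> W W' dW dW'; exists (W `&` W') => // z; exact: filterI.
- move=> A W [H Hf HA] dW; have [s Hs Ws] := pxy _ _ dW Hf.
  by exists s; split=> //; exact: HA.
have dq : deltaS q.
  move=> s _; split=> //; apply: Eq; exists [set s].
    by split; [exact: finite_set1|exists s].
  by move=> t; apply.
exists q => //.
have [a qa] := limit_along_exists x qU; have [b qb] := limit_along_exists y qU.
exists b; split=> //; suff <- : a = b by [].
apply: contrapT => /off_diagonal[W [dW [[P Q] /= [aP bQ] PQW]]].
have := filter_ex (filterI (filterI (qa _ aP) (qb _ bQ)) (qW _ dW)).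
by move=> [s [[/= Ps Qs] Ws]]; exact: (PQW (_, _) (conj Ps Qs) Ws).
Qed.

(** Syndeticity puts the return times of [y] to each neighbourhood into some
[q] in [L]; compactness of [L] produces one [q] for all neighbourhoods. *)
Lemma uniformly_recurrent_fixed y L : uniformly_recurrent y ->
  left_ideal L -> uclosed L -> exists2 q, L q & limit_along q y y.
Proof.
move=> ury LI cL; have [L0 LdS _] := LI.
have CP := common_proper cL L0.
have [|||q] := @ultra_refines S _ (nbhs y)
    (fun V => [set s | V (dact s y)]) (common L) _.
- by exists setT; exact: filterT.
- by move=> V W yV yW; exists (V `&` W) => //; exact: filterI.
- move=> A V LA yV; have [q [[_ qV] Lq]] := ury V yV L LI.
  have qP := deltaS_proper (LdS _ Lq).
  exact: filter_ex (filterI (LA _ Lq) qV).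
- by rewrite -cL => Lq qV; exists q.
Qed.

Lemma fixing_uclosed y K : uclosed K ->
  uclosed [set q | K q /\ limit_along q y y].
Proof.
move=> cK.
pose E := [set [set s | V (dact s y)] | V in nbhs y].
rewrite (_ : [set q | _] = K `&` hull E).
  by apply: uclosedI => //; exact: hull_uclosed.
rewrite eqEsubset; split=> q [Kq].
  move=> qy; split=> //; split=> [|_ [V yV <-]]; last exact: qy.
  by move: Kq; rewrite cK => -[].
by move=> [qU Eq]; split=> // V yV; apply: Eq; exists V.
Qed.

Lemma minimal_idempotent_limit x y : uniformly_recurrent y -> proximal x y ->
  exists2 p, minimal_idempotent p & limit_along p x y.
Proof.
move=> ury /proximal_common_limit[r dr [z [xz yz]]].
have [|M [Mr cM Mmin]] := minimal_left_ideal_exists (principal_left_ideal dr).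
  by apply: bmul_uclosed => //; exact: uclosed_deltaS.
have [MI _] := Mmin; have [_ MdS _] := MI.
have [q Mq qy] := uniformly_recurrent_fixed ury MI cM.
have [||||p [Mp py] pid] := @ellis S [set q | M q /\ limit_along q y y].
- exact: fixing_uclosed.
- by exists q.
- by move=> ? [/MdS].
- move=> a b [Ma ay] [Mb yb]; split; first exact: left_ideal_subsemigroup.
  by apply: limit_along_bmul ay => //; exact: MdS.
exists p; first exact: idempotent_minimal Mmin Mp pid.
have [u du up] := Mr _ Mp; have pU := deltaS_ultra (MdS _ Mp).
have [w uw] := limit_along_exists z (deltaS_ultra du).
have pyw : limit_along p y w by rewrite -up; exact: limit_along_bmul uw.
rewrite (limit_along_unique pU py pyw) -up.
exact: limit_along_bmul uw.
Qed.

Lemma minimal_idempotent_recurrent p x y : minimal_idempotent p ->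
  limit_along p x y -> uniformly_recurrent y.
Proof.
move=> pmin xy V yV L LI; have [[dp _] _] := pmin; have [_ LdS _] := LI.
have [q Lq qp] := minimal_idempotent_absorb pmin LI.
have qU := deltaS_ultra (LdS _ Lq); have pU := deltaS_ultra dp.
have [z yz] := limit_along_exists y qU.
have xz : limit_along p x z.
  by rewrite -qp; apply: limit_along_bmul yz => //; exact: LdS.
have zy := limit_along_unique pU xz xy; rewrite zy in yz.
by exists q; split=> //; split=> //; exact: yz.
Qed.

Lemma idempotent_proximal p x y : idempotent p -> limit_along p x y ->
  proximal x y.
Proof.
move=> [dp pp] xy W H dW [Hf _]; have pU := deltaS_ultra dp.
have yy : limit_along p y y.
  have [z yz] := limit_along_exists y pU.
  have xz : limit_along p x z by rewrite -pp; exact: limit_along_bmul yz.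
  by rewrite {2}(limit_along_unique pU xy xz).
have [[P Q] /= [yP yQ] PQW] := dW y.
have := filter_ex (filterI (deltaS_sigma dp Hf) (filterI (xy _ yP) (yy _ yQ))).
by move=> [s [Hs [/= Ps Qs]]]; exists s => //; exact: (PQW (_, _)).
Qed.

End Dynamics.

(** * The shift system *)

Section Shift.
Variable S : partialSemigroup.

(** [None] plays the role of an adjoined identity, at which an orbit can be
evaluated to recover a set of return times exactly. The index type is made
classical because the product topology is developed for index types with
decidable equality. *)
Definition shift_space : topologicalType :=
  {ptws option {classic S} -> bool}.

(** Right translation of the argument, with value [false] where the product is
undefined. Associativity of the partial product makes this default harmless:
[(u s) t] and [u (s t)] are defined simultaneously once [s t] is. *)
Definition shift (s : S) (f : shift_space) : shift_space := fun o =>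
  if o is Some t then
    if pmul t s is Some ts then f (Some ts) else false
  else f (Some s).

Lemma shift_space_compact : compact [set: shift_space].
Proof.
have := @tychonoff (option {classic S}) (fun=> bool) _ (fun=> bool_compact).
by congr (compact _); rewrite eqEsubset.
Qed.

Lemma shift_space_hausdorff : hausdorff_space shift_space.
Proof.
apply: (@hausdorff_product (option {classic S}) (fun=> bool)) => o.
exact: discrete_hausdorff.
Qed.

Lemma eval_continuous (o : option {classic S}) :
  continuous (fun f : shift_space => f o).
Proof. exact: (@proj_continuous _ (fun=> bool)). Qed.

Lemma shift_continuous s : continuous (shift s).
Proof.
move=> f; apply/cvg_sup => o.
apply: (@continuous_comp_initial _ _ _ (fun g : shift_space => g o)).
case: o => [t|]; last exact: eval_continuous.
rewrite /comp /=; case: (pmul t s) => [ts|]; first exact: eval_continuous.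
exact: cst_continuous.
Qed.

Lemma shiftM s t st : pmul s t = Some st -> shift s \o shift t = shift st.
Proof.
move=> e; apply/funext => f; apply/funext => -[u|] /=; last by rewrite /= e.
have := pmulA u s t; rewrite e /=.
by case: (pmul u s) => [us|] /= <-.
Qed.

Definition shift_system : dynamicalSystem S :=
  DynamicalSystem shift_space_compact shift_space_hausdorff
    shift_continuous shiftM.

End Shift.

(** * Central sets are the dynamically central sets *)

Lemma central_dynamically_central (S : partialSemigroup) (B : set S) :
  central B -> dynamically_central B.
Proof.
move=> [p pmin pB]; have [pid _] := pmin; have pU := deltaS_ultra pid.1.
pose x : shift_system S := fun o => if o is Some s then `[< B s >] else false.
have [y xy] := limit_along_exists x pU.
pose U : set (shift_system S) := [set f | f None].
have UE : [set s | U (dact s x)] = B.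
  by rewrite predeqE => s; split=> [/asboolP|Bs] //; exact/asboolP.
have nbhsNone (z : shift_system S) b : z None = b ->
    nbhs z [set f : shift_system S | f None = b].
  move=> zb; apply: (@eval_continuous S None z [set b]).
  by rewrite /= zb; exact: discrete_set1.
exists (shift_system S), x, y, U; split=> //.
- apply: (nbhsNone _ true); case yN : (y None) => //.
  have := filter_ex (filterI pB (xy _ (nbhsNone _ _ yN))).
  by rewrite -UE /U => -[s [/= ->]].
- exact: minimal_idempotent_recurrent xy.
- exact: idempotent_proximal xy.
Qed.

Lemma dynamically_central_central (S : partialSemigroup) (B : set S) :
  dynamically_central B -> central B.
Proof.
move=> [X [x [y [U [yU ury pxy ->]]]]].
have [p pmin xy] := minimal_idempotent_limit ury pxy.
by exists p => //; exact: xy.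
Qed.

Theorem theorem2p23 (S : partialSemigroup) (hS : adequate S) (B : set S) :
  central B <-> dynamically_central B.
Proof.
split; [exact: central_dynamically_central|exact: dynamically_central_central].
Qed.
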